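(* Let $\Phi=\{\phi_1,\dots,\phi_n\}\subset L^\infty(X)$ and let $\mathcal M_{dg}:L^\infty(X)\to\mathbb C^{m_{dg}}$ be an ideal sampler satisfying $A^*A=G$, where $A\in\mathbb C^{m_{dg}\times n}$ represents $\mathcal M_{dg}\mathcal T$. Let $\mathcal T=\sum_{i=1}^{\hat n}\sigma_iu_iv_i^*$ be the singular value decomposition of the synthesis operator $\mathcal T$ associated with $\Phi$. Then, for every $$x\in\bigcup_{i\,:\,0<\sigma_i\le u\sigma_1}\{x\in X\,:\,u_i(x)\ne0\},$$ it holds that $$\sup_{\Delta A\,:\,\|\Delta A\|_2\le u\|A\|_2}\left\|\phi(x)(A+\Delta A)^\dagger\right\|_2^2=\infty .$$
   Context: $X\subseteq\mathbb R^d$ is measurable and $\rho$ is a non-atomic probability measure on $X$, with $\langle f,g\rangle_{L^2_\rho}=\int_X\overline f g\,d\rho$. $\mathcal T:\mathbb C^n\to L^2(X,\rho)$, $\mathcal Tc=\sum_{i=1}^nc_i\phi_i$. $G\in\mathbb C^{n\times n}$ is the Gram matrix $(G)_{i,j}=\langle\phi_i,\phi_j\rangle_{L^2_\rho}$, representing $\mathcal T^*\mathcal T$. $\phi(x)=[\phi_1(x)\ \cdots\ \phi_n(x)]\in\mathbb C^{1\times n}$. $\hat n=\dim\mathrm{span}(\Phi)$ ($\Phi$ need not be linearly independent); in the singular value decomposition, $\sigma_1\ge\dots\ge\sigma_{\hat n}>0$, $\{v_i\}$ is orthonormal in $\mathbb C^n$, and $\{u_i\}$ is an orthonormal basis of $\mathrm{span}(\Phi)$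 in $L^2(X,\rho)$, given pointwise by $u_i(x)=\sigma_i^{-1}\phi(x)v_i$. $\mathcal M_{dg}$ is a bounded linear operator from $(L^\infty(X),\|\cdot\|_{L^\infty})$ to $(\mathbb C^{m_{dg}},\|\cdot\|_2)$. $\Delta A$ ranges over $\mathbb C^{m_{dg}\times n}$; $^\dagger$ is the Moore–Penrose inverse; $\|\cdot\|_2$ is the Euclidean/spectral norm; $u>0$ is the unit roundoff. *)

(* Defs.v *)
From HB Require Import structures.
From mathcomp Require Export all_boot all_order all_algebra.
From mathcomp Require Export complex.
From mathcomp Require Export all_classical all_reals all_analysis.
Export Order.TTheory GRing.Theory Num.Theory.
Export numFieldNormedType.Exports.

Set Implicit Arguments.
Unset Strict Implicit.
Unset Printing Implicit Defensive.

Local Open Scope classical_set_scope.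
Local Open Scope complex_scope.
Local Open Scope sesquilinear_scope.
Local Open Scope ring_scope.

Section Euclidean.
Context {R : realType}.

Definition enorm n (v : 'cV[R[i]]_n) : R :=
  Num.sqrt (\sum_(k < n) ComplexField.Normc.normc (v k ord0) ^+ 2).

Definition spectral_norm m n (A : 'M[R[i]]_(m, n)) : R :=
  sup [set enorm (A *m c) | c in [set c : 'cV[R[i]]_n | enorm c <= 1]].

Definition penrose m n (A : 'M[R[i]]_(m, n)) (B : 'M[R[i]]_(n, m)) : Prop :=
  [/\ A *m B *m A = A, B *m A *m B = B,
      (A *m B)^t* = A *m B & (B *m A)^t* = B *m A].

(* [pinv_penrose] and [penrose_uniq] below show that the default value 0 is
   never used and that the choice is forced. *)
Definition pinv m n (A : 'M[R[i]]_(m, n)) : 'M[R[i]]_(n, m) :=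
  xget 0 [set B | penrose A B].

Let trmxCM m n p (A : 'M[R[i]]_(m, n)) (B : 'M[R[i]]_(n, p)) :
  (A *m B)^t* = B^t* *m A^t*.
Proof. by rewrite trmx_mul map_mxM. Qed.

Let gram_unit m n (F : 'M[R[i]]_(m, n)) : row_free F -> F *m F^t* \in unitmx.
Proof.
move=> rF; rewrite -row_free_unit -kermx_eq0.
apply/eqP/row_matrixP => k; rewrite row0; set w := row k _.
have w0 : w *m (F *m F^t* ) = 0.
  by apply/sub_kermxP; rewrite row_sub.
have : (w *m F) *m (w *m F)^t* = 0.
  by rewrite trmxCM mulmxA -(mulmxA w) w0 mul0mx.
move=> /(congr1 (fun M : 'M[R[i]]_1 => M ord0 ord0)); rewrite -dotmxE mxE => /eqP.
rewrite dnorm_eq0 => /eqP wF.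
by apply: (row_free_inj rF); rewrite wF mul0mx.
Qed.

Let penrose_ex m n (A : 'M[R[i]]_(m, n)) : exists B, penrose A B.
Proof.
have [r [C [F [AE rF rC]]]] : exists r (C : 'M[R[i]]_(m, r)) F,
    [/\ A = C *m F, row_free F & row_full C].
  exists (\rank A), (col_base A), (row_base A).
  by rewrite mulmx_base row_base_free col_base_full.
have uF : F *m F^t* \in unitmx by exact: gram_unit.
have uC : C^t* *m C \in unitmx.
  rewrite -{2}(trmxCK C); apply: gram_unit.
  by rewrite /row_free mxrank_map mxrank_tr.
pose P := invmx (F *m F^t* ); pose Q := invmx (C^t* *m C).
have hP : F *m F^t* *m P = 1%:M by rewrite mulmxV.
have hQ : Q *m (C^t* *m C) = 1%:M by rewrite mulVmx.
have herm k (H : 'M[R[i]]_k) : H^t* = H -> (invmx H)^t* = invmx H.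
  by move=> hH; rewrite trmx_inv map_invmx hH.
have PH : P^t* = P by apply: herm; rewrite trmxCM trmxCK.
have QH : Q^t* = Q by apply: herm; rewrite trmxCM trmxCK.
pose B := F^t* *m P *m Q *m C^t*.
have AB : A *m B = C *m Q *m C^t*.
  by rewrite AE /B !mulmxA -(mulmxA C F) -(mulmxA C _ P) hP mulmx1.
have BA : B *m A = F^t* *m P *m F.
  by rewrite AE /B !mulmxA -(mulmxA _ (C^t* ) C) -(mulmxA _ Q) hQ mulmx1.
exists B; split.
- by rewrite AB AE !mulmxA -(mulmxA _ (C^t* ) C) -(mulmxA _ Q) hQ mulmx1.
- by rewrite BA /B !mulmxA -(mulmxA _ F) -(mulmxA _ _ P) hP mulmx1.
- by rewrite AB !trmxCM trmxCK QH mulmxA.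
- by rewrite BA !trmxCM trmxCK PH mulmxA.
Qed.

Lemma penrose_uniq m n (A : 'M[R[i]]_(m, n)) B C :
  penrose A B -> penrose A C -> B = C.
Proof.
move=> [aba bab abh bah] [aca cac ach cah].
have AB : A *m B = A *m C.
  rewrite -abh -{1}aca -(mulmxA _ A) trmxCM ach abh.
  by rewrite mulmxA aba.
have BA : B *m A = C *m A.
  rewrite -bah -{1}aca -!mulmxA mulmxA trmxCM bah cah.
  by rewrite -mulmxA (mulmxA A) aba.
by rewrite -bab -mulmxA AB mulmxA BA cac.
Qed.

Lemma pinv_penrose m n (A : 'M[R[i]]_(m, n)) : penrose A (pinv A).
Proof.
have [B AB] := penrose_ex A.
by apply: (@xgetPex _ 0 [set B | penrose A B]); exists B.
Qed.

End Euclidean.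

Section FunctionSpaces.
Context {R : realType} {d : nat}.
Implicit Types (X : set (d.-tuple R)) (f g : d.-tuple R -> R[i]).

(* Elements of the function spaces on X are represented by functions on the
   whole of R^d whose values outside X are irrelevant. *)

Definition cmeasurable X f : Prop :=
  measurable_fun X (fun x => complex.Re (f x)) /\
  measurable_fun X (fun x => complex.Im (f x)).

Definition cintegral (rho : {measure set (d.-tuple R) -> \bar R}) X f : R[i] :=
  Rintegral rho X (fun x => complex.Re (f x)) +i*
  Rintegral rho X (fun x => complex.Im (f x)).

Definition l2dot (rho : {measure set (d.-tuple R) -> \bar R}) X f g : R[i] :=
  cintegral rho X (fun x => (f x)^* * g x).

Definition non_atomic (rho : {measure set (d.-tuple R) -> \bar R}) : Prop :=
  forall E, measurable E -> (0 < rho E)%E ->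
    exists F, [/\ measurable F, F `<=` E, (0 < rho F)%E & (rho F < rho E)%E].

(* L^oo(X) is taken with respect to a reference measure mu on R^d: mu = rho or
   mu = Lebesgue measure gives the essential supremum norm, mu = counting
   measure the supremum norm (for which point evaluations are bounded). *)
Definition Linfty_norm (mu : {measure set (d.-tuple R) -> \bar R}) X
    (mX : measurable X) f : \bar R :=
  Lnorm (mrestr mu mX) +oo%E (fun x => (ComplexField.Normc.normc (f x))%:E).

Definition Linfty (mu : {measure set (d.-tuple R) -> \bar R}) X
    (mX : measurable X) f : Prop :=
  cmeasurable X f /\ (Linfty_norm mu mX f < +oo)%E.

Definition bounded_linear_sampler (mu : {measure set (d.-tuple R) -> \bar R}) X
    (mX : measurable X) m (M : (d.-tuple R -> R[i]) -> 'cV[R[i]]_m) : Prop :=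
  (forall (a : R[i]) f g, Linfty mu mX f -> Linfty mu mX g ->
     M (fun x => a * f x + g x) = a *: M f + M g) /\
  (exists K : R, forall f, Linfty mu mX f ->
     ((enorm (M f))%:E <= K%:E * Linfty_norm mu mX f)%E).

End FunctionSpaces.

Section Synthesis.
Context {R : realType} {d n : nat}.
Variables (rho : {measure set (d.-tuple R) -> \bar R}) (X : set (d.-tuple R)).
Variable phi : 'I_n -> d.-tuple R -> R[i].

Definition phi_row (x : d.-tuple R) : 'rV[R[i]]_n := \row_i phi i x.

Definition synthesis (c : 'cV[R[i]]_n) : d.-tuple R -> R[i] :=
  fun x => \sum_(i < n) c i ord0 * phi i x.

Definition gram : 'M[R[i]]_n := \matrix_(i, j) l2dot rho X (phi i) (phi j).

Definition ae_free (S : {set 'I_n}) : Prop :=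
  forall c : 'cV[R[i]]_n, (forall i, i \notin S -> c i ord0 = 0) ->
    {ae rho, forall x, X x -> synthesis c x = 0} -> c = 0.

(* Dimension of span(Phi) as a subspace of L^2(X, rho), that is, modulo
   rho-almost everywhere equality: the largest size of a free subfamily. *)
Definition dim_span : nat := \max_(S : {set 'I_n} | `[< ae_free S >]) #|S|.

Definition l2_span (f : d.-tuple R -> R[i]) : Prop :=
  exists c : 'cV[R[i]]_n, {ae rho, forall x, X x -> f x = synthesis c x}.

Definition orthonormal_basis_of_span r (us : 'I_r -> d.-tuple R -> R[i]) :
    Prop :=
  [/\ forall k, cmeasurable X (us k) /\ l2_span (us k),
      forall k l, l2dot rho X (us k) (us l) = (k == l)%:R
    & forall f, cmeasurable X f -> l2_span f -> exists a : 'I_r -> R[i],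
        {ae rho, forall x, X x -> f x = \sum_(k < r) a k * us k x}].

(* T = \sum_k sigma_k u_k v_k^*, with u_k evaluated pointwise on X. *)
Definition synthesis_svd r (sigma : r.-tuple R)
    (us : 'I_r -> d.-tuple R -> R[i]) (vs : 'I_r -> 'cV[R[i]]_n) : Prop :=
  [/\ sorted >=%R sigma /\ (forall k, 0 < tnth sigma k),
      forall k l, (vs k)^t* *m vs l = (k == l)%:R%:M,
      orthonormal_basis_of_span us,
      forall k x, X x ->
        us k x = ((tnth sigma k)%:C)^-1 * (phi_row x *m vs k) ord0 ord0
    & forall c : 'cV[R[i]]_n, {ae rho, forall x, X x ->
        synthesis c x = \sum_(k < r)
          (tnth sigma k)%:C * ((vs k)^t* *m c) ord0 ord0 * us k x}].

End Synthesis.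

(* Main.v *)
Require Import Defs.
From mathcomp Require Import measurable_realfun ess_sup_inf.
From mathcomp Require Import ring lra.

Local Open Scope classical_set_scope.
Local Open Scope complex_scope.
Local Open Scope sesquilinear_scope.
Local Open Scope ring_scope.

(** Damping [A] along a single right singular vector already makes the supremum
    infinite.

    Write [v], [s] for the right singular vector and the singular value of the
    index given by [x], so [0 < s <= u * sigma_0] and [u_i x != 0].  Since the
    Gram matrix represents [T^* T], the decomposition of [T] gives
    [G v = s^2 v] ([gram_mul_right_singular]); as [A^* A = G], the pair [(s, v)]
    is a right singular pair of [A] as well, and so is [(sigma_0, v_0)].  In
    particular [|A v| = s], and [sigma_0 <= |A|].

    For [0 < e <= 1] let [DA = (e - 1) A v v^*] ([shrink]).  Its norm is at most
    [s <= u * sigma_0 <= u |A|], so it is an admissible perturbation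
    ([spectral_norm_shrink]).  The matrix [B = A + DA] still has [v] as a right
    singular vector, but with singular value [e s]: [B v = e A v] and
    [B^* B v = (e s)^2 v].  Hence [v] lies in the range of [B^*], on which
    the pseudo-inverse inverts [B] ([pinv_mulmxK]), so that
    [phi(x) v = e (phi(x) B^+) (A v)].  By Cauchy-Schwarz
    [|phi(x) v| <= e s |phi(x) B^+|] ([enorm_pinv_shrink]), and
    [phi(x) v = s u_i(x)]: the norm of [phi(x) B^+] is at least [|u_i(x)| / e],
    which is unbounded as [e] tends to 0.

    The equation [G v = s^2 v] is an interchange of sums and integrals: the
    entries of [G v] are integrals of [conj phi_j * T v] with [T v = s u], and
    expanding [phi_j] in the orthonormal family [u_k], almost everywhere, leaves
    one coefficient.  All functions involved are essentially bounded for [rho],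
    since essential boundedness for the reference measure [mu] passes to [rho]
    by absolute continuity ([Linfty_cess_bounded]), and [rho] is finite; so
    every integrand is integrable. *)

(** * Euclidean and spectral norms *)

Section EuclideanNorm.
Set Implicit Arguments.
Unset Strict Implicit.
Context {R : realType}.
Local Notation normc := ComplexField.Normc.normc.

Lemma normr_normc (z : R[i]) : `|z| = (normc z)%:C.
Proof. by []. Qed.

Lemma normc_ge0 (z : R[i]) : 0 <= normc z.
Proof. by rewrite -lecR -normr_normc normr_ge0. Qed.

Lemma normc_sqr (z : R[i]) : (normc z ^+ 2)%:C = Num.conj z * z.
Proof. by rewrite rmorphXn /= -normr_normc normCKC. Qed.

Lemma normcM (x y : R[i]) : normc (x * y) = normc x * normc y :> R.
Proof. exact: ComplexField.Normc.normcM. Qed.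

Lemma enorm_ge0 n (v : 'cV[R[i]]_n) : 0 <= enorm v.
Proof. exact: sqrtr_ge0. Qed.

Lemma enorm_sqr n (v : 'cV[R[i]]_n) :
  enorm v ^+ 2 = \sum_(k < n) normc (v k ord0) ^+ 2.
Proof. by rewrite sqr_sqrtr // sumr_ge0 // => k _; rewrite sqr_ge0. Qed.

Lemma enorm_sqr_dot n (v : 'cV[R[i]]_n) :
  (enorm v ^+ 2)%:C = (v^t* *m v) ord0 ord0.
Proof.
rewrite enorm_sqr rmorph_sum /= mxE; apply: eq_bigr => k _.
by rewrite normc_sqr !mxE.
Qed.

(** Cauchy-Schwarz, in the row-times-column form in which all norms are
    estimated below. *)
Lemma normc_row_mul_le n (p : 'rV[R[i]]_n) (w : 'cV[R[i]]_n) :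
  normc ((p *m w) ord0 ord0) <= enorm p^T * enorm w.
Proof.
rewrite -ler_sqr ?nnegrE ?mulr_ge0 ?enorm_ge0 ?normc_ge0 //.
rewrite -lecR exprMn [leLHS]rmorphXn [leRHS]rmorphM /= -normr_normc.
rewrite !enorm_sqr_dot.
have : `|dotmx p (w^t*)| ^+ 2 <= dotmx p p * dotmx (w^t*) (w^t*).
  by have [] := CauchySchwarz (@dotmx R[i] n) p (w^t*).
rewrite !dotmxE !trmxCK => /le_trans; apply.
rewrite ler_wpM2r //; first by rewrite -enorm_sqr_dot ler0c sqr_ge0.
rewrite !mxE le_eqVlt; apply/orP; left; apply/eqP/eq_bigr => k _.
by rewrite !mxE mulrC.
Qed.

Lemma enormZ n (a : R[i]) (v : 'cV[R[i]]_n) :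
  enorm (a *: v) = normc a * enorm v.
Proof.
apply/eqP; rewrite -(@eqrXn2 _ 2) ?mulr_ge0 ?enorm_ge0 ?normc_ge0 // exprMn.
rewrite !enorm_sqr mulr_sumr; apply/eqP/eq_bigr => k _.
by rewrite mxE normcM exprMn.
Qed.

Lemma enorm0 n : enorm (0 : 'cV[R[i]]_n) = 0.
Proof. by rewrite -(scale0r 0) enormZ ComplexField.Normc.normc0 mul0r. Qed.

Lemma spectral_norm_le m n (A : 'M[R[i]]_(m, n)) (K : R) :
  (forall c, enorm c <= 1 -> enorm (A *m c) <= K) -> spectral_norm A <= K.
Proof.
move=> AK; apply: ge_sup.
  by exists (enorm (A *m 0)), 0 => //=; rewrite enorm0 ler01.
by move=> _ [c /= c1 <-]; exact: AK.
Qed.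

(** The point is that the supremum defining the spectral norm is taken over a
    bounded set; the Frobenius norm of [A] is an upper bound. *)
Lemma enorm_mulmx_le m n (A : 'M[R[i]]_(m, n)) c :
  enorm c <= 1 -> enorm (A *m c) <= spectral_norm A.
Proof.
move=> c1; apply: ub_le_sup; last by exists c.
exists (Num.sqrt (\sum_(k < m) enorm (row k A)^T ^+ 2)) => _ [{c1}c /= c1 <-].
rewrite ler_wsqrtr // ler_sum // => k _.
rewrite ler_sqr ?nnegrE ?enorm_ge0 ?normc_ge0 //.
have -> : (A *m c) k ord0 = (row k A *m c) ord0 ord0.
  by rewrite -row_mul [RHS]mxE.
apply: le_trans (normc_row_mul_le _ _) _.
by rewrite ler_piMr ?enorm_ge0.
Qed.

(** * Perturbing a matrix along a singular vector *)

(** The Penrose equations make [pinv B *m B] Hermitian, so that taking adjoints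
    in [B *m pinv B *m B = B] shows that it fixes the range of the adjoint
    of [B]. *)
Lemma pinv_mulmxK m n (B : 'M[R[i]]_(m, n)) (w : 'cV[R[i]]_m) :
  pinv B *m B *m (B^t* *m w) = B^t* *m w.
Proof.
have [BPB _ _ PBh] := pinv_penrose B.
by rewrite -[in LHS]PBh mulmxA -map_mxM -trmx_mul mulmxA BPB.
Qed.

Section SingularPair.
Context {m n : nat} (A : 'M[R[i]]_(m, n)) (v : 'cV[R[i]]_n) (s : R).
Hypotheses (s_gt0 : 0 < s) (v_unit : v^t* *m v = 1%:M)
  (Av : A^t* *m A *m v = (s ^+ 2)%:C *: v).

Lemma enorm_singular_vector : enorm v = 1.
Proof.
apply/eqP; rewrite -(@eqrXn2 _ 2) ?enorm_ge0 // expr1n.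
by rewrite -(inj_eq (@complexI R)) enorm_sqr_dot v_unit mxE.
Qed.

Lemma enorm_mul_singular_vector : enorm (A *m v) = s.
Proof.
apply/eqP; rewrite -(@eqrXn2 _ 2) ?enorm_ge0 ?ltW //.
rewrite -(inj_eq (@complexI R)) enorm_sqr_dot trmx_mul map_mxM.
by rewrite -mulmxA (mulmxA (A^t* )) Av -scalemxAr v_unit !mxE mulr1.
Qed.

(** Adding this rank-one matrix to [A] multiplies its singular value at [v] by
    [e] and leaves [A] unchanged on the orthogonal complement of [v]. *)
Definition shrink (e : R) : 'M[R[i]]_(m, n) := (e%:C - 1) *: (A *m v *m v^t*).

(** The perturbation sends [c] to a multiple of [A *m v], whose
    length is [s], and the factor is at most [1 - e] in modulus. *)
Lemma spectral_norm_shrink (e : R) : 0 < e <= 1 -> spectral_norm (shrink e) <= s.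
Proof.
move=> /andP[e0 e1]; apply: spectral_norm_le => c c1.
have -> : shrink e *m c = ((e%:C - 1) * (v^t* *m c) ord0 ord0) *: (A *m v).
  rewrite -scalemxAl -mulmxA {1}[v^t* *m c]mx11_scalar mul_mx_scalar scalerA.
  by congr (_ *: _); congr (_ * _ _ _); apply: val_inj.
rewrite enormZ enorm_mul_singular_vector ler_piMl ?(ltW s_gt0) //.
rewrite normcM; apply: mulr_ile1; rewrite ?normc_ge0 //.
  have -> : e%:C - 1 = (e - 1)%:C :> R[i] by rewrite rmorphB rmorph1.
   rewrite -lecR -normr_normc normc_def /= expr0n addr0 sqrtr_sqr lecR ler_norml; lra.
apply: le_trans (normc_row_mul_le _ _) _.
have -> : enorm (v^t*)^T = enorm v.
  congr Num.sqrt; apply: eq_bigr => k _; congr (_ ^+ 2).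
  by apply: (@complexI R); rewrite -!normr_normc !mxE norm_conjC.
by rewrite enorm_singular_vector mul1r.
Qed.

(** The shrunk matrix maps [v] to a vector of length [e * s] and its
    pseudo-inverse maps that vector back to [v]. *)
Lemma enorm_pinv_shrink (e : R) (p : 'rV[R[i]]_n) : 0 < e ->
  normc ((p *m v) ord0 ord0) / (e * s) <= enorm (p *m pinv (A + shrink e))^T.
Proof.
move=> e0; set B := A + shrink e.
have Bv : B *m v = e%:C *: (A *m v).
  rewrite mulmxDl -scalemxAl -!mulmxA v_unit mulmx1 -{1}(scale1r (A *m v)).
  by rewrite -scalerDl addrC subrK.
have BBv : B^t* *m (B *m v) = (e ^+ 2 * s ^+ 2)%:C *: v.
  rewrite Bv -scalemxAr linearD map_mxD mulmxDl mulmxA Av.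
  rewrite linearZ /= map_mxZ trmx_mul map_mxM trmxCK trmx_mul map_mxM.
  rewrite -scalemxAl -!mulmxA (mulmxA _ A) Av -scalemxAr v_unit.
  rewrite -scalemxAr mulmx1 scalerA -scalerDl scalerA; congr (_ *: v).
  rewrite rmorphB rmorph1 /=.
  have -> : Num.conj (e%:C : R[i]) = e%:C by rewrite -[RHS]conjc_real.
  have -> : (e ^+ 2 * s ^+ 2)%:C = e%:C * (e%:C * (s ^+ 2)%:C) :> R[i].
    by rewrite [e ^+ 2]expr2 -mulrA [LHS]rmorphM; congr (_ * _); rewrite rmorphM.
  ring.
have es0 : e ^+ 2 * s ^+ 2 != 0 by rewrite mulf_neq0 // expf_neq0 // gt_eqF.
have PBv : pinv B *m B *m v = v.
  (* The eigenvector equation exhibits [v] in the range of the adjoint of [B]. *)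
  have -> : v = B^t* *m (((e ^+ 2 * s ^+ 2)%:C)^-1 *: (B *m v)).
    rewrite -scalemxAr BBv scalerA mulVf ?scale1r //.
    by rewrite (inj_eq (@complexI R)).
  exact: pinv_mulmxK.
have -> : p *m v = (p *m pinv B) *m (e%:C *: (A *m v)).
  by rewrite -Bv -!mulmxA (mulmxA (pinv B)) PBv.
rewrite ler_pdivrMr ?mulr_gt0 //; apply: le_trans (normc_row_mul_le _ _) _.
rewrite enormZ enorm_mul_singular_vector.
suff -> : normc (e%:C : R[i]) = e by [].
by apply: (@complexI R); rewrite -normr_normc ger0_norm // ler0c ltW.
Qed.

End SingularPair.
End EuclideanNorm.

(** * Integrals of essentially bounded complex functions *)

Section Integration.
Set Implicit Arguments.
Unset Strict Implicit.
Context {R : realType} {d : nat}.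
Local Notation T := (d.-tuple R).
Local Notation normc := ComplexField.Normc.normc.
Variables (rho : {measure set T -> \bar R}) (X : set T).
Hypotheses (mX : measurable X) (rhoX : (rho X < +oo)%E).

(** Unlike integrability, essential boundedness is stable under products; on a
    set of finite measure it implies integrability. *)
Definition ess_bounded (h : T -> R) : Prop :=
  measurable_fun X h /\ exists K : R, {ae rho, forall x, X x -> `|h x| <= K}.

Lemma ess_bounded_cst a : ess_bounded (fun=> a).
Proof.
by split; [exact: measurable_cst | exists `|a|; exact: aeW].
Qed.

Lemma ess_boundedD f g :
  ess_bounded f -> ess_bounded g -> ess_bounded (fun x => f x + g x).
Proof.
move=> [mf [K fK]] [mg [L gL]]; split; first exact: measurable_funD.
exists (K + L); apply: filterS2 fK gL => x fK gL Xx.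
by rewrite (le_trans (ler_normD _ _)) // lerD ?fK ?gL.
Qed.

Lemma ess_boundedN f : ess_bounded f -> ess_bounded (fun x => - f x).
Proof.
move=> [mf [K fK]]; split; first exact: measurableT_comp.
by exists K; apply: filterS fK => x fK Xx; rewrite normrN fK.
Qed.

Lemma ess_boundedM f g :
  ess_bounded f -> ess_bounded g -> ess_bounded (fun x => f x * g x).
Proof.
move=> [mf [K fK]] [mg [L gL]]; split; first exact: measurable_funM.
exists (K * L); apply: filterS2 fK gL => x fK gL Xx.
by rewrite normrM ler_pM ?fK ?gL.
Qed.

Lemma ess_bounded_integrable f :
  ess_bounded f -> rho.-integrable X (EFin \o f).
Proof.
move=> [mf [K fK]]; apply/integrableP; split; first exact/measurable_EFinP.
apply: (@le_lt_trans _ _ (`|K|%:E * rho X)%E); last by rewrite lte_mul_pinfty.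
apply: integral_le_bound => //; first exact/measurable_EFinP.
apply: filterS fK => x fK Xx; rewrite lee_fin (le_trans (fK Xx)) //.
exact: ler_norm.
Qed.

Definition cess_bounded (f : T -> R[i]) : Prop :=
  ess_bounded (fun x => complex.Re (f x)) /\
  ess_bounded (fun x => complex.Im (f x)).

Lemma cess_bounded_cst a : cess_bounded (fun=> a).
Proof. by split; exact: ess_bounded_cst. Qed.

Lemma cess_boundedD f g :
  cess_bounded f -> cess_bounded g -> cess_bounded (fun x => f x + g x).
Proof.
move=> [fr fi] [gr gi]; split.
  under eq_fun do rewrite raddfD; exact: ess_boundedD.
under eq_fun do rewrite raddfD; exact: ess_boundedD.
Qed.

Lemma ReM (a b : R[i]) :
  complex.Re (a * b) = complex.Re a * complex.Re b - complex.Im a * complex.Im b.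
Proof. by case: a b => [? ?] []. Qed.

Lemma ImM (a b : R[i]) :
  complex.Im (a * b) = complex.Re a * complex.Im b + complex.Im a * complex.Re b.
Proof. by case: a b => [? ?] []. Qed.

Lemma Re_conj (a : R[i]) : complex.Re (Num.conj a) = complex.Re a.
Proof. by case: a. Qed.

Lemma Im_conj (a : R[i]) : complex.Im (Num.conj a) = - complex.Im a.
Proof. by case: a. Qed.

Lemma cess_boundedM f g :
  cess_bounded f -> cess_bounded g -> cess_bounded (fun x => f x * g x).
Proof.
move=> [fr fi] [gr gi]; split.
  under eq_fun do rewrite ReM.
  exact: ess_boundedD (ess_boundedM fr gr) (ess_boundedN (ess_boundedM fi gi)).
under eq_fun do rewrite ImM.
exact: ess_boundedD (ess_boundedM fr gi) (ess_boundedM fi gr).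
Qed.

Lemma cess_bounded_conj f :
  cess_bounded f -> cess_bounded (fun x => Num.conj (f x)).
Proof.
move=> [fr fi]; split.
  by under eq_fun do rewrite Re_conj.
under eq_fun do rewrite Im_conj.
exact: ess_boundedN.
Qed.

Lemma cess_bounded_sum (I : Type) (s : seq I) (h : I -> T -> R[i]) :
  (forall k, cess_bounded (h k)) -> cess_bounded (fun x => \sum_(k <- s) h k x).
Proof.
move=> hb; elim: s => [|k s IHs].
  under eq_fun do rewrite big_nil; exact: cess_bounded_cst.
under eq_fun do rewrite big_cons; exact: cess_boundedD.
Qed.

Lemma cess_bounded_eq_on f g :
  (forall x, X x -> f x = g x) -> cess_bounded f -> cess_bounded g.
Proof.
move=> fg [[mfr [K frK]] [mfi [L fiL]]]; split; split.
- by apply: eq_measurable_fun mfr => x /[!inE] Xx; rewrite fg.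
- by exists K; apply: filterS frK => x frK Xx; rewrite -fg ?frK.
- by apply: eq_measurable_fun mfi => x /[!inE] Xx; rewrite fg.
- by exists L; apply: filterS fiL => x fiL Xx; rewrite -fg ?fiL.
Qed.

Lemma cintegralD f g : cess_bounded f -> cess_bounded g ->
  cintegral rho X (fun x => f x + g x) = cintegral rho X f + cintegral rho X g.
Proof.
move=> [fr fi] [gr gi]; rewrite /cintegral.
under eq_Rintegral do rewrite raddfD.
under [X in _ +i* X]eq_Rintegral do rewrite raddfD.
by rewrite !RintegralD //; exact: ess_bounded_integrable.
Qed.

Lemma cintegralZ a f : cess_bounded f ->
  cintegral rho X (fun x => a * f x) = a * cintegral rho X f.
Proof.
move=> [fr fi]; rewrite /cintegral.
under eq_Rintegral do rewrite ReM.
under [X in _ +i* X]eq_Rintegral do rewrite ImM.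
have cM c h : ess_bounded h -> rho.-integrable X (EFin \o (fun x => c * h x)).
  move=> hb; apply: ess_bounded_integrable.
  by apply: ess_boundedM => //; exact: ess_bounded_cst.
rewrite RintegralB ?RintegralD //; [|exact: cM..].
by rewrite !RintegralZl //; [|exact: ess_bounded_integrable..]; case: a.
Qed.

Lemma cintegral_lincomb (I : Type) (s : seq I) (a : I -> R[i])
    (h : I -> T -> R[i]) : (forall k, cess_bounded (h k)) ->
  cintegral rho X (fun x => \sum_(k <- s) a k * h k x) =
  \sum_(k <- s) a k * cintegral rho X (h k).
Proof.
move=> hb; elim: s => [|k s IHs].
  rewrite big_nil /cintegral.
  under eq_Rintegral do rewrite big_nil.
  under [X in _ +i* X]eq_Rintegral do rewrite big_nil.
  by rewrite !Rintegral_cst // mul0r.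
have ab j : cess_bounded (fun x => a j * h j x).
  by apply: cess_boundedM => //; exact: cess_bounded_cst.
rewrite big_cons -IHs -cintegralZ // -cintegralD //; last exact: cess_bounded_sum.
by congr cintegral; apply/funext => x; rewrite big_cons.
Qed.

Lemma ae_eq_cintegral f g : cmeasurable X f -> cmeasurable X g ->
  {ae rho, forall x, X x -> f x = g x} -> cintegral rho X f = cintegral rho X g.
Proof.
move=> [fr fi] [gr gi] fg; congr (_ +i* _); congr fine; apply: ae_eq_integral => //.
all: try exact/measurable_EFinP.
all: by apply: filterS fg => x fg Xx; rewrite fg.
Qed.

Lemma ae_mrestr_dominated (mu : {measure set T -> \bar R}) (P : T -> Prop) :
  rho `<< mu -> {ae mrestr mu mX, forall x, P x} ->
  {ae rho, forall x, X x -> P x}.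
Proof.
move=> /null_content_dominatesP rho_mu [N [mN N0 PN]].
exists (N `&` X); split; first exact: measurableI.
  by apply: rho_mu => //; exact: measurableI.
by move=> x /= /not_implyP[Xx nP]; split => //; exact: PN.
Qed.

(** Real and imaginary parts are bounded by the modulus.  If [X] is
    [mu]-negligible the norm is 0 by convention and carries no information, but
    then [X] is [rho]-negligible too and any bound holds almost everywhere. *)
Lemma Linfty_cess_bounded (mu : {measure set T -> \bar R}) f :
  rho `<< mu -> Linfty mu mX f -> cess_bounded f.
Proof.
move=> rho_mu [[mfr mfi] f_lty].
have [K fK] : exists K : R, {ae rho, forall x, X x -> normc (f x) <= K}.
  move: f_lty; rewrite /Linfty_norm unlock; case: ifPn => [_ f_lty|].
    have [K fK] := ess_supr_bounded f_lty.
    exists K; apply: (ae_mrestr_dominated rho_mu).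
    apply: filterS fK => x; exact: le_trans (ler_norm _).
  rewrite -leNgt measure_le0 => /eqP; rewrite [LHS](_ : _ = mu X); last first.
    by congr (mu _); rewrite setTI.
  move=> muX _.
  exists 0, X; split => //; first by move/null_content_dominatesP: rho_mu; exact.
  by move=> x /= /not_implyP[].
split; split => //; exists K; apply: filterS fK => x fK Xx.
  apply: le_trans (fK Xx); case: (f x) => a b /=.
  by rewrite -sqrtr_sqr ler_wsqrtr // lerDl sqr_ge0.
apply: le_trans (fK Xx); case: (f x) => a b /=.
by rewrite -sqrtr_sqr ler_wsqrtr // lerDr sqr_ge0.
Qed.

(** * Right singular vectors of the synthesis operator *)

Lemma phi_row_mul n (phi : 'I_n -> T -> R[i]) (c : 'cV[R[i]]_n) x :
  (phi_row phi x *m c) ord0 ord0 = synthesis phi c x.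
Proof. by rewrite mxE; apply: eq_bigr => i _; rewrite mxE mulrC. Qed.

(** With [phi_j = \sum_k b_k u_k] almost everywhere and [T v_l = sigma_l u_l],
    the [j]-th entry of [G v_l] is the inner product of [phi_j] and
    [sigma_l u_l], that is, the conjugate of [b_l] times [sigma_l]; and [b_l] is
    [sigma_l] times the conjugate of the [j]-th entry of [v_l]. *)
Lemma gram_mul_right_singular n r (phi : 'I_n -> T -> R[i]) (sigma : r.-tuple R)
    (us : 'I_r -> T -> R[i]) (vs : 'I_r -> 'cV[R[i]]_n) (l : 'I_r) :
  (forall i, cess_bounded (phi i)) -> synthesis_svd rho X phi sigma us vs ->
  gram rho X phi *m vs l = (tnth sigma l ^+ 2)%:C *: vs l.
Proof.
move=> phib [[_ sigma_gt0] _ [_ us_orth _] usE phiE].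
have sigma_neq0 k : (tnth sigma k)%:C != 0 :> R[i].
  by rewrite (inj_eq (@complexI R)) gt_eqF.
have usb k : cess_bounded (us k).
  pose g x := \sum_(i < n) ((tnth sigma k)%:C^-1 * vs k i ord0) * phi i x.
  apply: (@cess_bounded_eq_on g) => [x Xx|].
    rewrite usE // phi_row_mul mulr_sumr.
    by apply: eq_bigr => i _; rewrite mulrA.
  apply: cess_bounded_sum => i; apply: cess_boundedM => //.
  exact: cess_bounded_cst.
have dotb f g : cess_bounded f -> cess_bounded g ->
    cess_bounded (fun x => Num.conj (f x) * g x).
  by move=> fb gb; apply: cess_boundedM => //; exact: cess_bounded_conj.
have lincomb_meas (I : Type) (s : seq I) (a : I -> R[i]) (h : I -> T -> R[i]) :
    (forall k, cess_bounded (h k)) ->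
    cmeasurable X (fun x => \sum_(k <- s) a k * h k x).
  move=> hb.
  suff [[? _] [? _]] : cess_bounded (fun x => \sum_(k <- s) a k * h k x) by [].
  apply: cess_bounded_sum => k; apply: cess_boundedM => //.
  exact: cess_bounded_cst.
apply/matrixP => j o; rewrite (ord1 o) [LHS]mxE [RHS]mxE.
(* The coordinates of [phi j], which is the synthesis of the [j]-th unit
   vector, in the orthonormal family [us]. *)
pose b k := (tnth sigma k)%:C * ((vs k)^t* *m (delta_mx j ord0 : 'cV_n)) ord0 ord0.
have phi_ae : {ae rho, forall x, X x -> phi j x = \sum_(k < r) b k * us k x}.
  apply: filterS (phiE (delta_mx j ord0)) => x + Xx => /(_ Xx) <-.
  rewrite /synthesis (bigD1 j) //= mxE !eqxx mul1r big1 ?addr0 // => i ij.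
  by rewrite mxE (negPf ij) mul0r.
transitivity (cintegral rho X (fun x =>
    \sum_(i < n) vs l i ord0 * (Num.conj (phi j x) * phi i x))).
  rewrite cintegral_lincomb; last by move=> i; exact: dotb.
  by apply: eq_bigr => i _; rewrite mxE mulrC.
transitivity (cintegral rho X (fun x => \sum_(k < r)
    (Num.conj (b k) * (tnth sigma l)%:C) * (Num.conj (us k x) * us l x))).
  apply: ae_eq_cintegral; [by apply: lincomb_meas => i; exact: dotb..|].
  apply: filterS phi_ae => x phi_x Xx.
  transitivity (Num.conj (phi j x) * ((tnth sigma l)%:C * us l x)).
    rewrite usE // mulVKf // phi_row_mul mulr_sumr.
    by apply: eq_bigr => i _; rewrite mulrCA.
  rewrite phi_x // rmorph_sum mulr_suml; apply: eq_bigr => k _.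
  by rewrite rmorphM /=; ring.
rewrite cintegral_lincomb; last by move=> k; exact: dotb.
rewrite (bigD1 l) //= big1 ?addr0 => [|k kl]; last first.
  by rewrite [X in _ * X]us_orth (negPf kl) mulr0.
rewrite [X in _ * X]us_orth eqxx mulr1 /b mxE (bigD1 j) //=.
rewrite big1 => [|i ij]; last first.
  by rewrite [X in _ * X]mxE (negPf ij) mulr0.
rewrite addr0 !mxE !eqxx mulr1 rmorphM /= conjCK.
have -> : Num.conj ((tnth sigma l)%:C : R[i]) = (tnth sigma l)%:C.
  by rewrite -[RHS]conjc_real.
by rewrite rmorphXn /=; ring.
Qed.

End Integration.

Theorem theorem32 (R : realType) (d n m r : nat)
    (X : set (d.-tuple R)) (mX : measurable X)
    (rho : probability (d.-tuple R) R) (rhoX : rho X = 1%E)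
    (rho_na : non_atomic rho)
    (mu : {measure set (d.-tuple R) -> \bar R}) (rho_mu : rho `<< mu)
    (phi : 'I_n -> d.-tuple R -> R[i])
    (phi_Linfty : forall i, Linfty mu mX (phi i))
    (M : (d.-tuple R -> R[i]) -> 'cV[R[i]]_m)
    (M_sampler : bounded_linear_sampler mu mX M)
    (A : 'M[R[i]]_(m, n))
    (A_repr : forall c : 'cV[R[i]]_n, A *m c = M (synthesis phi c))
    (A_ideal : A^t* *m A = gram rho X phi)
    (r_dim : r = dim_span rho X phi)
    (sigma : r.-tuple R) (us : 'I_r -> d.-tuple R -> R[i])
    (vs : 'I_r -> 'cV[R[i]]_n)
    (svd : synthesis_svd rho X phi sigma us vs)
    (u : R) (u_gt0 : 0 < u) :
  forall x, (\bigcup_(i in [set i : 'I_r | 0 < tnth sigma i <= u * sigma`_0])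
               [set x | X x /\ us i x != 0]) x ->
    ereal_sup [set (enorm (phi_row phi x *m pinv (A + DA))^T ^+ 2)%:E
              | DA in [set DA : 'M[R[i]]_(m, n) |
                        spectral_norm DA <= u * spectral_norm A]] = +oo%E.
Proof.
move=> x [k /= /andP[sk_gt0 sk_le] [Xx uskx]].
have phib i : cess_bounded rho X (phi i).
  exact: Linfty_cess_bounded rho_mu (phi_Linfty i).
have rhoX_fin : (rho X < +oo)%E by rewrite rhoX ltry.
have Avs l : A^t* *m A *m vs l = (tnth sigma l ^+ 2)%:C *: vs l.
  by rewrite A_ideal; exact: gram_mul_right_singular svd.
have [[_ sigma_gt0] vs_orth _ usE _] := svd.
have vs_unit l : (vs l)^t* *m vs l = 1%:M by rewrite vs_orth eqxx.
have sk_norm : tnth sigma k <= u * spectral_norm A.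
  have r_gt0 : (0 < r)%N by exact: leq_ltn_trans (leq0n k) (ltn_ord k).
  apply: le_trans sk_le _; rewrite ler_pM2l //.
  have -> : sigma`_0 = tnth sigma (Ordinal r_gt0) by rewrite (tnth_nth 0).
  rewrite -(enorm_mul_singular_vector (sigma_gt0 _) (vs_unit _) (Avs _)).
  by apply: enorm_mulmx_le; rewrite enorm_singular_vector ?vs_unit.
set a := ComplexField.Normc.normc (us k x).
have a_gt0 : 0 < a.
  rewrite lt_def normc_ge0 andbT; apply: contra_neq uskx.
  exact: ComplexField.Normc.eq0_normc.
apply/eqyP => K K_gt0.
(* This makes the lower bound [a / e] equal to [a + K + 1], whose square
   exceeds [K], while keeping [e <= 1]. *)
pose e := a / (a + K + 1).
have e01 : 0 < e <= 1.
  rewrite divr_gt0 /=; [|lra..].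
  by rewrite ler_pdivrMr; lra.
have pv : (phi_row phi x *m vs k) ord0 ord0 = (tnth sigma k)%:C * us k x.
  by rewrite usE // mulVKf // (inj_eq (@complexI R)) gt_eqF.
pose DA := shrink A (vs k) e.
have lower : a + K + 1 <= enorm (phi_row phi x *m pinv (A + DA))^T.
  have /andP[e_gt0 _] := e01.
  apply: le_trans
    (enorm_pinv_shrink sk_gt0 (vs_unit k) (Avs k) (phi_row phi x) e_gt0).
  rewrite pv normcM -/a.
  have -> : ComplexField.Normc.normc ((tnth sigma k)%:C : R[i]) = tnth sigma k.
    by apply: (@complexI R); rewrite -normr_normc ger0_norm // ler0c ltW.
  have e_mul : e * (a + K + 1) = a by rewrite /e divfK // gt_eqF //; lra.
  rewrite ler_pdivlMr; last exact: mulr_gt0.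
  by rewrite -[in leRHS]e_mul le_eqVlt; apply/orP; left; apply/eqP; ring.
apply: le_ereal_sup_tmp.
exists ((enorm (phi_row phi x *m pinv (A + DA))^T ^+ 2)%:E).
  exists DA => //=.
  apply: le_trans sk_norm.
  exact: (spectral_norm_shrink sk_gt0 (vs_unit k) (Avs k)).
by rewrite lee_fin; nra.
Qed.
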